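(* Let $G$ be the Markov parameter matrix of an observable and controllable system $(A,B,C,D)$ of order $n$, and let $\hat G\in\mathbb R^{m\times Tp}$ be arbitrary, with associated matrices $H^+,L,O,Q$ and $\hat H^+,\hat L,\hat O,\hat Q$ as in the context. Let $\bar A,\bar B,\bar C$ be the output of the Ho–Kalman algorithm with input $G$ and $\hat A,\hat B,\hat C$ the output with input $\hat G$. Suppose $\sigma_{\min}(L)>0$ and $$\|L-\hat L\|\le\sigma_{\min}(L)/2.$$ Then there exists a unitary (real orthogonal) matrix $S\in\mathbb R^{n\times n}$ such that $$\|\bar C-\hat CS\|_F\le\|O-\hat OS\|_F\le\sqrt{5n\|L-\hat L\|},$$ $$\|\bar B-S^*\hat B\|_F\le\|Q-S^*\hat Q\|_F\le\sqrt{5n\|L-\hat L\|}.$$ Furthermore, the hidden state matrices satisfy $$\|\bar A-S^*\hat AS\|_F\le\frac{14\sqrt n}{\sigma_{\min}(L)}\left(\sqrt{\frac{\|L-\hat L\|}{\sigma_{\min}(L)}}\,\big(\|H^+\|+\|H^+-\hat H^+\|\big)+\|H^+-\hat H^+\|\right).$$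
   Context: $\|\cdot\|$ is the spectral norm, $\|\cdot\|_F$ the Frobenius norm, $X^*$ the transpose, $X^\dagger$ the Moore–Penrose inverse. System: $A\in\mathbb R^{n\times n}$, $B\in\mathbb R^{n\times p}$, $C\in\mathbb R^{m\times n}$, $D\in\mathbb R^{m\times p}$, with $(A,B)$ controllable and $(C,A)$ observable (stability is not assumed). Let $T=T_1+T_2+1$ and $G=[D,CB,CAB,\dots,CA^{T-2}B]\in\mathbb R^{m\times Tp}$. For a block matrix $X=[X_1,\dots,X_T]\in\mathbb R^{m\times Tp}$ with $m\times p$ blocks, the $(T_1,T_2+1)$ clipped Hankel matrix $H(X)\in\mathbb R^{mT_1\times p(T_2+1)}$ is the $T_1\times(T_2+1)$ block matrix with $(i,j)$ block $X_{i+j}$. Put $H=H(G)$, $\hat H=H(\hat G)$. $H^-,\hat H^-$ denote the first $pT_2$ columns, and $H^+,\hat H^+$ the last $pT_2$ columns, of $H,\hat H$. Standing assumption: $T_1,T_2$ are such that $H^-$ (the $(T_1,T_2)$ Hankel matrix of $G$) has rank $n$. $L$ and $\hat L$ are the best rank-$n$ approximations (SVD truncated to the top $n$ singular values) of $H^-$ and $\hat H^-$; thus $L=H^-$. $\sigma_{\min}(L)$ is the $n$th largest (smallest nonzero) singular value of $L$. Ho–Kalman algorithm (input $\hat G$): take an SVD $\hat L=\hat U\hat\Sigma\hat V^*$ with $\hat\Sigma\in\mathbb R^{n\times n}$, set $\hat O=\hat U\hat\Sigma^{1/2}\in\mathbb R^{mT_1\times n}$ and $\hat Q=\hat\Sigma^{1/2}\hat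 V^*\in\mathbb R^{n\times pT_2}$; output $\hat C$ = first $m$ rows of $\hat O$, $\hat B$ = first $p$ columns of $\hat Q$, and $\hat A=\hat O^\dagger\hat H^+\hat Q^\dagger$. With input $G$: $L=U\Sigma V^*$, $O=U\Sigma^{1/2}$, $Q=\Sigma^{1/2}V^*$, $\bar C$ = first $m$ rows of $O$, $\bar B$ = first $p$ columns of $Q$, $\bar A=O^\dagger H^+Q^\dagger$. *)

(* Defs.v *)
From mathcomp Require Import all_boot all_order all_algebra.
From mathcomp Require Import all_classical all_reals.

Set Implicit Arguments.
Unset Strict Implicit.
Unset Printing Implicit Defensive.

Import Order.TTheory GRing.Theory Num.Theory.
Local Open Scope classical_set_scope.
Local Open Scope ring_scope.

(* A matrix made of T blocks of size d has dimension \sum_(i < T) d, which is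
   provably but not definitionally T * d; this is the shape required by the
   block operations mxblock, mxrow, submxrow, ... of the matrix library. *)
Definition blk (T d : nat) : nat := (\sum_(i < T) d)%N.

Section MatrixNotions.
Variable R : realType.

Definition frob_norm m n (A : 'M[R]_(m, n)) : R :=
  Num.sqrt (\sum_i \sum_j A i j ^+ 2).

(* Induced by the Euclidean norm, which is frob_norm on column vectors. The norm
   `|A| that MathComp-Analysis puts on matrices is the max norm instead. *)
Definition spec_norm m n (A : 'M[R]_(m, n)) : R :=
  sup [set frob_norm (A *m x) | x in [set x : 'cV[R]_n | frob_norm x <= 1]].

Definition orthogonal_mx n (S : 'M[R]_n) : Prop :=
  S^T *m S = 1%:M /\ S *m S^T = 1%:M.

(* A = U diag(s) V^T with r orthonormal columns in U and in V, and
   s nonnegative and nonincreasing. *)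
Definition is_svd m n r (A : 'M[R]_(m, n))
    (U : 'M[R]_(m, r)) (s : 'rV[R]_r) (V : 'M[R]_(n, r)) : Prop :=
  [/\ A = U *m diag_mx s *m V^T,
      U^T *m U = 1%:M,
      V^T *m V = 1%:M,
      forall i, 0 <= s 0 i
    & forall i j : 'I_r, (i <= j)%N -> s 0 j <= s 0 i].

(* The default value 0 is never used: every matrix has an SVD, and s is the
   same in all of them. *)
Definition singular_values m n (A : 'M[R]_(m, n)) : 'rV[R]_(minn m n) :=
  xget 0 [set s | exists U V, is_svd A U s V].

(* k-th largest singular value, counted from k = 1 (0 if k is out of range). *)
Definition singular_value (k : nat) m n (A : 'M[R]_(m, n)) : R :=
  if k is k'.+1 then
    if insub k' is Some i then singular_values A 0 i else 0
  else 0.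

(* Not a function of A: if the k-th and (k+1)-st singular values coincide, the
   truncation depends on the SVD. *)
Definition is_svd_truncation (k : nat) m n (A L : 'M[R]_(m, n)) : Prop :=
  exists U (s : 'rV[R]_(minn m n)) V,
    is_svd A U s V /\
    L = U *m diag_mx (\row_i (if (i < k)%N then s 0 i else 0)) *m V^T.

(* The four Penrose equations. *)
Definition is_pinv m n (A : 'M[R]_(m, n)) (X : 'M[R]_(n, m)) : Prop :=
  [/\ A *m X *m A = A,
      X *m A *m X = X,
      (A *m X)^T = A *m X
    & (X *m A)^T = X *m A].

(* Not the library's pinvmx, which is only a partial inverse. The default
   value 0 is never used: every real matrix has a unique such X. *)
Definition pinv m n (A : 'M[R]_(m, n)) : 'M[R]_(n, m) :=
  xget 0 [set X | is_pinv A X].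

End MatrixNotions.

Section Systems.
Variables (R : realType) (n m p : nat).

Definition controllable (A : 'M[R]_n) (B : 'M[R]_(n, p)) : Prop :=
  \rank (\mxrow_(k < n) (A ^+ k *m B)) = n.

Definition observable (C : 'M[R]_(m, n)) (A : 'M[R]_n) : Prop :=
  \rank (\mxcol_(k < n) (C *m A ^+ k)) = n.

(* [D, C B, C A B, ..., C A^(T-2) B] *)
Definition markov (T : nat) (A : 'M[R]_n) (B : 'M[R]_(n, p))
    (C : 'M[R]_(m, n)) (D : 'M[R]_(m, p)) : 'M[R]_(m, blk T p) :=
  \mxrow_(k < T)
    (if nat_of_ord k is k'.+1 then C *m A ^+ k' *m B else D).

End Systems.

Section Hankel.
Variables (R : realType) (m p T1 T2 : nat).

(* With blocks counted from 1, block (i, j) is X_(i + j); counting all indices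
   from 0 it becomes X_(i + j + 1), which never exceeds T1 + T2, so that inord
   does not truncate. In particular the first block of X is not used. *)
Definition hankel (X : 'M[R]_(m, blk (T1 + T2).+1 p)) :
    'M[R]_(blk T1 m, blk T2.+1 p) :=
  \mxblock_(i < T1, j < T2.+1) submxrow X (inord (i + j).+1).

Definition hankel_minus (X : 'M[R]_(m, blk (T1 + T2).+1 p)) :
    'M[R]_(blk T1 m, blk T2 p) :=
  \mxrow_(j < T2) submxrow (hankel X) (widen_ord (leqnSn T2) j).

Definition hankel_plus (X : 'M[R]_(m, blk (T1 + T2).+1 p)) :
    'M[R]_(blk T1 m, blk T2 p) :=
  \mxrow_(j < T2) submxrow (hankel X) (lift ord0 j).

End Hankel.

(* One run of the algorithm on X with order n. It is a relation because the
   truncation L of the Hankel matrix and the SVD of L are arbitrary choices;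
   O, Q, A, B, C are determined by these choices. *)
Definition ho_kalman (R : realType) (n m p T1 T2 : nat)
    (hT1 : (0 < T1)%N) (hT2 : (0 < T2)%N)
    (X : 'M[R]_(m, blk (T1 + T2).+1 p)) (L : 'M[R]_(blk T1 m, blk T2 p))
    (O : 'M[R]_(blk T1 m, n)) (Q : 'M[R]_(n, blk T2 p))
    (A : 'M[R]_n) (B : 'M[R]_(n, p)) (C : 'M[R]_(m, n)) : Prop :=
  is_svd_truncation n (hankel_minus X) L /\
  exists U (s : 'rV[R]_n) V,
    [/\ is_svd L U s V,
        O = U *m diag_mx (map_mx Num.sqrt s)
      & Q = diag_mx (map_mx Num.sqrt s) *m V^T] /\
    [/\ C = submxcol O (Ordinal hT1),
        B = submxrow Q (Ordinal hT2)
      & A = pinv O *m hankel_plus X *m pinv Q].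

(* Main.v *)
Require Import Defs.
From mathcomp Require Import all_boot all_order all_algebra.
From mathcomp Require Import all_classical all_reals.
From mathcomp Require Import topology normedtype derive.
From mathcomp Require Import ring lra.

(* Stack the balanced factors as W = [O; Q^T] and Z = [Ohat; Qhat^T], and choose
   the orthogonal S maximizing tr (S^T Z^T W), which makes S^T Z^T W symmetric
   positive semidefinite. A Procrustes estimate then bounds sigma_min |W - Z S|^2
   by a multiple of |W W^T - Z Z^T|^2, which balancedness bounds by
   4 |L - Lhat|^2 (Frobenius norms), and |L - Lhat|^2 <= 2 n eps^2 because L and
   Lhat have rank at most n.
   Since L expands an n-dimensional subspace by sigma_min, Lhat expands it by
   sigma_min / 2, so every diagonal entry in the SVD of Lhat is at least
   sigma_min / 2; this bounds the pseudoinverses, and Wedin's identity for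
   differences of pseudoinverses transfers the bounds to A. *)

Set Implicit Arguments.
Unset Strict Implicit.
Unset Printing Implicit Defensive.

Import Order.TTheory GRing.Theory Num.Theory.
Import numFieldNormedType.Exports.
Local Open Scope ring_scope.

(** * The Frobenius norm *)

Lemma trmxD (V : nmodType) m n (A B : 'M[V]_(m, n)) :
  (A + B)^T = A^T + B^T.
Proof. exact: raddfD. Qed.

Lemma trmx_scale (R : pzRingType) m n (a : R) (A : 'M[R]_(m, n)) :
  (a *: A)^T = a *: A^T.
Proof. exact: linearZ. Qed.

Lemma trmxB (V : zmodType) m n (A B : 'M[V]_(m, n)) :
  (A - B)^T = A^T - B^T.
Proof. exact: raddfB. Qed.

Lemma mxtraceB (V : zmodType) n (A B : 'M[V]_n) : \tr (A - B) = \tr A - \tr B.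
Proof. exact: raddfB. Qed.

Lemma mxtraceN (V : zmodType) n (A : 'M[V]_n) : \tr (- A) = - \tr A.
Proof. exact: raddfN. Qed.

Section FrobeniusNorm.
Variable R : realType.
Implicit Types m n k : nat.

Lemma mxtrace_trmx_mul m n (A B : 'M[R]_(m, n)) :
  \tr (A^T *m B) = \sum_i \sum_j A i j * B i j.
Proof.
rewrite exchange_big; apply: eq_bigr => j _; rewrite mxE.
by apply: eq_bigr => i _; rewrite mxE.
Qed.

Lemma mxtrace_trmx_mulC m n (A B : 'M[R]_(m, n)) :
  \tr (A^T *m B) = \tr (B^T *m A).
Proof. by rewrite -mxtrace_tr trmx_mul trmxK. Qed.

Lemma frob_norm_ge0 m n (A : 'M[R]_(m, n)) : 0 <= frob_norm A.
Proof. exact: sqrtr_ge0. Qed.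

Lemma frob_norm_sqr m n (A : 'M[R]_(m, n)) : frob_norm A ^+ 2 = \tr (A^T *m A).
Proof.
rewrite mxtrace_trmx_mul sqr_sqrtr; last first.
  by apply: sumr_ge0 => i _; apply: sumr_ge0 => j _; exact: sqr_ge0.
by apply: eq_bigr => i _; apply: eq_bigr => j _; rewrite expr2.
Qed.

Lemma mxtrace_trmx_mul_ge0 m n (A : 'M[R]_(m, n)) : 0 <= \tr (A^T *m A).
Proof. by rewrite -frob_norm_sqr sqr_ge0. Qed.

Lemma le_frob_norm m n k l (A : 'M[R]_(m, n)) (B : 'M[R]_(k, l)) (c : R) :
  0 <= c -> frob_norm A ^+ 2 <= c ^+ 2 * frob_norm B ^+ 2 ->
  frob_norm A <= c * frob_norm B.
Proof.
move=> c0; rewrite -exprMn ler_pXn2r // nnegrE ?mulr_ge0 ?frob_norm_ge0 //.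
Qed.

Lemma frob_norm_tr m n (A : 'M[R]_(m, n)) : frob_norm A^T = frob_norm A.
Proof.
rewrite /frob_norm exchange_big; congr Num.sqrt.
by apply: eq_bigr => i _; apply: eq_bigr => j _; rewrite mxE.
Qed.

Lemma frob_norm0 m n : frob_norm (0 : 'M[R]_(m, n)) = 0.
Proof.
apply/eqP; rewrite -sqrf_eq0 frob_norm_sqr.
by rewrite mulmx0 mxtrace0.
Qed.

Lemma frob_norm_eq0 m n (A : 'M[R]_(m, n)) : frob_norm A = 0 -> A = 0.
Proof.
move/(congr1 (fun x => x ^+ 2)); rewrite frob_norm_sqr mxtrace_trmx_mul expr0n /=.
have ge0 i : 0 <= \sum_j A i j * A i j.
  by apply: sumr_ge0 => j _; rewrite -expr2 sqr_ge0.
move=> /eqP; rewrite psumr_eq0 // => /allP A0; apply/matrixP => i j.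
move: (A0 i); rewrite mem_index_enum => /(_ isT) /=.
rewrite psumr_eq0; last by move=> ? _; rewrite -expr2 sqr_ge0.
move=> /allP /(_ j); rewrite mem_index_enum => /(_ isT) /=.
by rewrite mulf_eq0 orbb mxE => /eqP.
Qed.

Lemma frob_norm_CS m n (A B : 'M[R]_(m, n)) :
  \tr (A^T *m B) <= frob_norm A * frob_norm B.
Proof.
set a := frob_norm A; set b := frob_norm B.
have [a0|a0] := eqVneq a 0.
  by rewrite a0 mul0r (frob_norm_eq0 a0) trmx0 mul0mx mxtrace0.
have [b0|b0] := eqVneq b 0.
  by rewrite b0 mulr0 (frob_norm_eq0 b0) mulmx0 mxtrace0.
have ab : 0 < a * b by rewrite mulr_gt0 // lt_def ?a0 ?b0 frob_norm_ge0.
(* This squared norm equals 2 a b (a b - tr (A^T B)), and a b > 0. *)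
have := mxtrace_trmx_mul_ge0 (b *: A - a *: B).
rewrite trmxB !trmx_scale mulmxBl !mulmxBr -!scalemxAl -!scalemxAr.
rewrite !mxtraceB !mxtraceZ -!frob_norm_sqr -/a -/b (mxtrace_trmx_mulC B A).
move=> h; rewrite -(ler_pM2l ab); nra.
Qed.

Lemma frob_norm_triangle m n (A B : 'M[R]_(m, n)) :
  frob_norm (A + B) <= frob_norm A + frob_norm B.
Proof.
rewrite -(ler_pXn2r (_ : 0 < 2)%N) ?nnegrE ?addr_ge0 ?frob_norm_ge0 //.
rewrite frob_norm_sqr trmxD mulmxDl !mulmxDr !mxtraceD.
rewrite -!frob_norm_sqr (mxtrace_trmx_mulC B A).
have := frob_norm_CS A B; nra.
Qed.

Lemma frob_normZ m n (c : R) (A : 'M[R]_(m, n)) :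
  0 <= c -> frob_norm (c *: A) = c * frob_norm A.
Proof.
move=> c0; apply/eqP; rewrite -(@eqrXn2 _ 2) ?mulr_ge0 ?frob_norm_ge0 //.
rewrite exprMn !frob_norm_sqr trmx_scale -scalemxAl -scalemxAr !mxtraceZ.
by rewrite mulrA -expr2.
Qed.

Lemma frob_normN m n (A : 'M[R]_(m, n)) : frob_norm (- A) = frob_norm A.
Proof.
by rewrite /frob_norm; under eq_bigr do under eq_bigr do rewrite mxE sqrrN.
Qed.

Lemma frob_norm_col_mx m1 m2 n (A : 'M[R]_(m1, n)) (B : 'M[R]_(m2, n)) :
  frob_norm (col_mx A B) ^+ 2 = frob_norm A ^+ 2 + frob_norm B ^+ 2.
Proof. by rewrite !frob_norm_sqr tr_col_mx mul_row_col raddfD. Qed.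

Lemma frob_norm_rowsub m m' n (f : 'I_m' -> 'I_m) (A : 'M[R]_(m, n)) :
  injective f -> frob_norm (rowsub f A) <= frob_norm A.
Proof.
move=> fI; rewrite ler_wsqrtr //.
have ge0 i : 0 <= \sum_j A i j ^+ 2 by apply: sumr_ge0 => j _; exact: sqr_ge0.
rewrite [leRHS](bigID (mem [set f i | i : 'I_m'])%SET) /=.
rewrite big_imset /=; last by move=> i j _ _; exact: fI.
rewrite -[leLHS]addr0 lerD ?sumr_ge0 // le_eqVlt; apply/orP; left.
by apply/eqP/eq_bigr => i _; apply: eq_bigr => j _; rewrite mxE.
Qed.

Lemma frob_norm_sum_col m n (A : 'M[R]_(m, n)) :
  frob_norm A ^+ 2 = \sum_j frob_norm (col j A) ^+ 2.
Proof.
rewrite frob_norm_sqr; apply: eq_bigr => j _.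
rewrite frob_norm_sqr mxtrace_trmx_mul mxE; apply: eq_bigr => i _.
by rewrite big_ord1 !mxE.
Qed.

Lemma frob_norm_isometry m n k (U : 'M[R]_(m, n)) (A : 'M[R]_(n, k)) :
  U^T *m U = 1%:M -> frob_norm (U *m A) = frob_norm A.
Proof.
move=> UU; apply/eqP; rewrite -(@eqrXn2 _ 2) ?frob_norm_ge0 // !frob_norm_sqr.
by rewrite trmx_mul mulmxA -(mulmxA A^T) UU mulmx1.
Qed.

Lemma frob_norm_orthonormal m n (U : 'M[R]_(m, n)) :
  U^T *m U = 1%:M -> frob_norm U ^+ 2 = n%:R.
Proof. by move=> UU; rewrite frob_norm_sqr UU mxtrace1. Qed.

(** Pythagoras for an orthogonal projection: [proj_sqr], applied to P and to 1 - P, turns both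
    squares into traces that are linear in the projection. *)
Lemma frob_norm_proj m n (P : 'M[R]_m) (A : 'M[R]_(m, n)) :
  P^T = P -> P *m P = P ->
  frob_norm A ^+ 2 = frob_norm (P *m A) ^+ 2 + frob_norm ((1%:M - P) *m A) ^+ 2.
Proof.
have proj_sqr (X : 'M[R]_m) : X^T = X -> X *m X = X ->
    frob_norm (X *m A) ^+ 2 = \tr (A^T *m (X *m A)).
  move=> Xs XX.
  by rewrite frob_norm_sqr trmx_mul Xs -mulmxA (mulmxA X) XX.
move=> Ps PP; rewrite !proj_sqr //.
- by rewrite frob_norm_sqr -mxtraceD -mulmxDr -mulmxDl addrC subrK mul1mx.
- by rewrite trmxB trmx1 Ps.
- by rewrite mulmxBl mul1mx mulmxBr mulmx1 PP subrr subr0.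
Qed.

Lemma frob_norm_proj_compl_le m n (P : 'M[R]_m) (A : 'M[R]_(m, n)) :
  P^T = P -> P *m P = P -> frob_norm ((1%:M - P) *m A) <= frob_norm A.
Proof.
move=> Ps PP; rewrite -[leRHS]mul1r; apply: le_frob_norm => //.
by rewrite expr1n mul1r (frob_norm_proj A Ps PP) lerDr sqr_ge0.
Qed.

End FrobeniusNorm.

(** * Polar decomposition *)

Section Polar.
Variable R : realType.
Implicit Types n : nat.

Lemma orthogonal_mxM n (S X : 'M[R]_n) :
  orthogonal_mx S -> orthogonal_mx X -> orthogonal_mx (S *m X).
Proof.
move=> [S1 S2] [X1 X2]; split; rewrite trmx_mul mulmxA.
  by rewrite -(mulmxA X^T) S1 mulmx1.
by rewrite -(mulmxA S) X2 mulmx1.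
Qed.

(* For v = 0 this is the identity, since 2 / 0 = 0. *)
Definition householder n (v : 'cV[R]_n) : 'M[R]_n :=
  1%:M - (2 / \tr (v^T *m v)) *: (v *m v^T).

Lemma householder_tr n (v : 'cV[R]_n) : (householder v)^T = householder v.
Proof. by rewrite trmxB trmx1 trmx_scale trmx_mul trmxK. Qed.

Lemma householder_orthogonal n (v : 'cV[R]_n) : orthogonal_mx (householder v).
Proof.
suff HH : householder v *m householder v = 1%:M.
  by split; rewrite householder_tr.
rewrite /householder; set b := 2 / _.
have vv : v *m v^T *m (v *m v^T) = \tr (v^T *m v) *: (v *m v^T).
  rewrite mulmxA -(mulmxA v) trace_mx11 [v^T *m v in LHS]mx11_scalar.
  by rewrite mul_mx_scalar -scalemxAl.
rewrite mulmxBl mul1mx mulmxBr mulmx1 -scalemxAl -scalemxAr vv !scalerA.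
have -> : b * b * \tr (v^T *m v) = b + b.
  rewrite /b; have [->|] := eqVneq (\tr (v^T *m v)) 0; last by move=> ?; field.
  by rewrite invr0 !mulr0 addr0.
by rewrite scalerDl opprB addrK subrK.
Qed.

(** Expanding both reflections leaves bilinear forms of P, so that a trace maximizer can be tested
    on plane rotations. *)
Lemma mxtrace_householder_mul2 n (u w : 'cV[R]_n) (P : 'M[R]_n) :
  \tr (householder u *m householder w *m P) =
  \tr P - 2 / \tr (u^T *m u) * \tr (u^T *m P *m u)
  - 2 / \tr (w^T *m w) * \tr (w^T *m P *m w)
  + 2 / \tr (u^T *m u) * (2 / \tr (w^T *m w)) *
    (\tr (u^T *m w) * \tr (w^T *m P *m u)).
Proof.
have rank1 v : \tr (v *m v^T *m P) = \tr (v^T *m P *m v).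
  by rewrite -mulmxA mxtrace_mulC.
rewrite /householder; set b := 2 / _; set c := 2 / _.
rewrite mulmxBl mul1mx mulmxBr mulmx1 -scalemxAl -scalemxAr scalerA.
rewrite !mulmxBl mul1mx -!scalemxAl !mxtraceB !mxtraceZ !rank1.
have -> : \tr (u *m u^T *m (w *m w^T) *m P) =
    \tr (u^T *m w) * \tr (w^T *m P *m u).
  rewrite -!mulmxA mxtrace_mulC !mulmxA -!(mulmxA (u^T *m w)).
  rewrite [u^T *m w in LHS]mx11_scalar mul_scalar_mx mxtraceZ.
  by rewrite (trace_mx11 (u^T *m w)).
ring.
Qed.

(** A continuous function attains its maximum on the compact orthogonal group. Matrices are
    flattened by [mxvec] because the compactness and extreme value theorems applied here concern row
    vectors. *)
Lemma exists_trace_max n (M : 'M[R]_n) : exists2 S : 'M[R]_n,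
  orthogonal_mx S &
  forall X, orthogonal_mx X -> \tr (X^T *m M) <= \tr (S^T *m M).
Proof.
pose K : set 'rV[R]_(n * n) :=
  [set v | (vec_mx v)^T *m vec_mx v = 1%:M :> 'M_n]%classic.
pose f (v : 'rV[R]_(n * n)) := \tr ((vec_mx v)^T *m M).
have coordC i j : continuous (fun v : 'rV[R]_(n * n) => vec_mx v i j : R).
  rewrite (_ : (fun _ => _) = (fun v : 'rV_(n * n) => v 0 (mxvec_index i j))).
    exact: coord_continuous.
  by apply/funext => v; rewrite mxE.
have sumC (F : 'I_n -> 'rV[R]_(n * n) -> R) : (forall i, continuous (F i)) ->
    continuous (fun v => \sum_i F i v).
  move=> FC; apply: continuous_big => //; exact: add_continuous.
have mulC (F1 F2 : 'rV[R]_(n * n) -> R) : continuous F1 -> continuous F2 ->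
    continuous (fun v => F1 v * F2 v).
  move=> F1C F2C v.
  by apply: (@continuousM R _ F1 F2 v); [exact: F1C | exact: F2C].
have fC : continuous f.
  rewrite (_ : f = fun v => \sum_i \sum_j vec_mx v i j * M i j); last first.
    by apply/funext => v; rewrite /f mxtrace_trmx_mul.
  apply: (sumC (fun i v => \sum_j vec_mx v i j * M i j)) => i.
  apply: (sumC (fun j v => vec_mx v i j * M i j)) => j.
  by apply: (mulC (fun v => vec_mx v i j)) => //; exact: cst_continuous.
have Kclosed : closed K.
  rewrite (_ : K = \bigcap_(ij in [set: 'I_n * 'I_n])
     [set v | \sum_k vec_mx v k ij.1 * vec_mx v k ij.2 = (ij.1 == ij.2)%:R])%classic.
    apply: closed_bigI => -[i j] _ /=.
    have /continuous_closedP h : continuous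
        (fun v : 'rV[R]_(n * n) => \sum_k vec_mx v k i * vec_mx v k j).
      by apply: (sumC (fun k v => vec_mx v k i * vec_mx v k j)) => k; exact: mulC.
    exact: h _ (@closed_eq R (i == j)%:R).
  apply/seteqP; split=> v /=.
    move=> vK [i j] _ /=; move/matrixP/(_ i j): vK; rewrite !mxE => <-.
    by apply: eq_bigr => k _; rewrite !mxE.
  move=> vK; apply/matrixP => i j; rewrite !mxE -(vK (i, j) I).
  by apply: eq_bigr => k _; rewrite !mxE.
(* The columns are unit vectors, so all entries lie in [-1, 1] and K is a closed subset of a
   cube. *)
have Kcompact : compact K.
  apply: subclosed_compact Kclosed (@rV_compact _ _
    (fun=> `[(-1 : R), 1]%classic) (fun=> @segment_compact _ _ _)) _.
  move=> v vK k /=; case/mxvec_indexP: k => i j.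
  have : vec_mx v i j ^+ 2 <= 1.
    move/matrixP/(_ j j): vK; rewrite !mxE eqxx mulr1n => <-.
    rewrite (bigD1 i) //= !mxE -expr2 lerDl sumr_ge0 // => k _.
    by rewrite !mxE -expr2 sqr_ge0.
  by rewrite mxE in_itv /= => h; apply/andP; split; nra.
have K0 : (K !=set0)%classic.
  by exists (mxvec 1%:M); rewrite /K /= mxvecK trmx1 mul1mx.
have [v vK vmax] := EVT_max_rV K0 Kcompact (continuous_subspaceT fC).
exists (vec_mx v).
  by move: vK; rewrite inE /K /= => vK; split=> //; apply: mulmx1C.
move=> X [XX _]; have := vmax (mxvec X); rewrite /f mxvecK; apply.
by rewrite inE /K /= mxvecK.
Qed.

(** For v nonzero, the reflection along v lowers the trace by 2 / |v|^2 times v^T P v, which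
    maximality forces to be nonnegative. *)
Lemma trace_max_psd n (P : 'M[R]_n) :
  (forall X, orthogonal_mx X -> \tr (X *m P) <= \tr P) ->
  forall v : 'cV[R]_n, 0 <= \tr (v^T *m P *m v).
Proof.
move=> Pmax v; have := Pmax _ (householder_orthogonal v).
rewrite mulmxBl mul1mx mxtraceB -scalemxAl mxtraceZ.
rewrite -(mulmxA v) (mxtrace_mulC v).
set t := \tr (v^T *m v); have t0 : 0 <= t by exact: mxtrace_trmx_mul_ge0.
have [t0'|tn0] := eqVneq t 0.
  move: t0'; rewrite /t -frob_norm_sqr => /eqP; rewrite sqrf_eq0 => /eqP.
  by move=> /frob_norm_eq0 -> _; rewrite mulmx0 mxtrace0.
have b0 : 0 < 2 / t by rewrite divr_gt0 // lt_def tn0.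
by rewrite gerBl pmulr_rge0.
Qed.

(** A small rotation in the plane of e_i and e_j changes the trace to first order by a multiple of
    P_ji - P_ij, which must vanish at a maximum. *)
Lemma trace_max_sym n (P : 'M[R]_n) :
  (forall X, orthogonal_mx X -> \tr (X *m P) <= \tr P) -> P^T = P.
Proof.
move=> Pmax; have psd := trace_max_psd Pmax.
pose e i : 'cV[R]_n := delta_mx i 0.
have eP i j : \tr ((e i)^T *m P *m e j) = P i j.
  by rewrite trmx_delta -rowE -colE trace_mx11 !mxE.
have ee i j : \tr ((e i)^T *m e j) = (i == j)%:R.
  by rewrite trmx_delta -rowE trace_mx11 !mxE andbT.
have ineq i j t : i != j -> t * (P j i - P i j) <= t ^+ 2 * (P i i + P j j).
  (* Test maximality on the product of the reflections along e_i and w, which is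
     a rotation in the plane of e_i and e_j. *)
  move=> ij; pose w := e i + t *: e j.
  have := Pmax _ (orthogonal_mxM (householder_orthogonal (e i))
                               (householder_orthogonal w)).
  have w2 : \tr (w^T *m w) = 1 + t ^+ 2.
    rewrite /w trmxD trmx_scale mulmxDl !mulmxDr -!scalemxAl -!scalemxAr.
    rewrite !mxtraceD !mxtraceZ !ee !eqxx (negbTE ij) eq_sym (negbTE ij) /=; ring.
  have uw : \tr ((e i)^T *m w) = 1.
    rewrite /w mulmxDr -scalemxAr mxtraceD mxtraceZ !ee eqxx (negbTE ij) /=; ring.
  rewrite mxtrace_householder_mul2 w2 uw ee eqxx divr1.
  rewrite /w trmxD trmx_scale !mulmxDl !mulmxDr -!scalemxAl -!scalemxAr.
  rewrite !mxtraceD !mxtraceZ !eP.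
  have t1 : 0 < 1 + t ^+ 2 by rewrite ltr_pwDl ?sqr_ge0.
  (* The rotation lowers the trace by exactly 2 / (1 + t^2) times the right side minus the left
     side. *)
  move=> h; rewrite -subr_ge0 -(pmulr_rge0 _ (divr_gt0 (ltr0n _ 2) t1)).
  move: h; rewrite -subr_ge0; congr (0 <= _); field; lra.
apply/matrixP => i j; rewrite mxE.
have [->//|ij] := eqVneq i j.
set a := P j i - P i j; set b := P i i + P j j.
have b0 : 0 <= b by rewrite addr_ge0 // -eP psd.
have b1 : b + 1 != 0 by lra.
(* At t = q := a / (b + 1) the inequality reads q^2 (b + 1) <= q^2 b, so q = 0 and a = 0. The 1 is
   added because b may vanish. *)
have := ineq i j (a / (b + 1)) ij; rewrite -/a -/b.
set q := a / (b + 1) => h.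
have aq : a = q * (b + 1) by rewrite /q divfK.
have q0 : q ^+ 2 = 0.
  apply/eqP; rewrite eq_le sqr_ge0 andbT; move: h; rewrite aq; nra.
move/eqP: q0; rewrite sqrf_eq0 => /eqP q0.
by apply/eqP; rewrite -subr_eq0 -/a aq q0 mul0r.
Qed.

(** Take S maximizing tr (S^T M). Comparing S with S X^T shows that no orthogonal X raises the trace
    of S^T M, and the two preceding lemmas apply. *)
Lemma polar n (M : 'M[R]_n) : exists S : 'M[R]_n,
  [/\ orthogonal_mx S, (S^T *m M)^T = S^T *m M &
      forall v : 'cV[R]_n, 0 <= \tr (v^T *m (S^T *m M) *m v)].
Proof.
have [S So Smax] := exists_trace_max M.
have Pmax X : orthogonal_mx X -> \tr (X *m (S^T *m M)) <= \tr (S^T *m M).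
  move=> [X1 X2]; rewrite mulmxA.
  have -> : X *m S^T = (S *m X^T)^T by rewrite trmx_mul trmxK.
  by apply: Smax; apply: orthogonal_mxM => //; split; rewrite trmxK.
by exists S; split=> //; [exact: trace_max_sym | exact: trace_max_psd].
Qed.

End Polar.

(** * Operator bounds and singular values *)

Section OperatorBound.
Variable R : realType.
Implicit Types m n k : nat.

(** An upper bound on the spectral norm, quantified over matrices X rather than vectors so that it
    directly gives the mixed estimates with Frobenius norms. *)
Definition op_le (c : R) m n (A : 'M[R]_(m, n)) :=
  forall k (X : 'M[R]_(n, k)), frob_norm (A *m X) <= c * frob_norm X.

Lemma op_leM m n k a b (A : 'M[R]_(m, n)) (B : 'M[R]_(n, k)) :
  0 <= a -> op_le a A -> op_le b B -> op_le (a * b) (A *m B).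
Proof.
move=> a0 hA hB l X; rewrite -mulmxA (le_trans (hA _ _)) // -mulrA.
by rewrite ler_wpM2l.
Qed.

Lemma op_leD m n a b (A B : 'M[R]_(m, n)) :
  op_le a A -> op_le b B -> op_le (a + b) (A + B).
Proof.
move=> hA hB l X; rewrite mulmxDl mulrDl.
by rewrite (le_trans (frob_norm_triangle _ _)) // lerD.
Qed.

Lemma op_leN m n a (A : 'M[R]_(m, n)) : op_le a A -> op_le a (- A).
Proof.
by move=> hA l X; rewrite mulNmx frob_normN.
Qed.

(** With x = |A^T X|, Cauchy-Schwarz gives x^2 = tr (X^T A A^T X) <= |X| c x; divide by x. *)
Lemma op_le_tr m n c (A : 'M[R]_(m, n)) : 0 <= c -> op_le c A -> op_le c A^T.
Proof.
move=> c0 hA k X; set x := frob_norm (A^T *m X).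
have [->|x0] := eqVneq x 0; first by rewrite mulr_ge0 ?frob_norm_ge0.
have xp : 0 < x by rewrite lt_def x0 frob_norm_ge0.
rewrite -(ler_pM2r xp) -expr2 frob_norm_sqr trmx_mul trmxK -mulmxA.
rewrite (le_trans (frob_norm_CS _ _)) //.
by rewrite (mulrC c) -mulrA ler_wpM2l ?frob_norm_ge0 ?hA.
Qed.

Lemma op_leMr m n k c (A : 'M[R]_(m, n)) (X : 'M[R]_(k, m)) :
  0 <= c -> op_le c A -> frob_norm (X *m A) <= frob_norm X * c.
Proof.
move=> c0 /(op_le_tr c0) hA.
by rewrite -frob_norm_tr trmx_mul -(frob_norm_tr X) mulrC; apply: hA.
Qed.

Lemma op_le_isometry m n (U : 'M[R]_(m, n)) : U^T *m U = 1%:M -> op_le 1 U.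
Proof. by move=> UU k X; rewrite frob_norm_isometry // mul1r. Qed.

Lemma frob_norm_mul m n k (A : 'M[R]_(m, n)) (X : 'M[R]_(n, k)) :
  frob_norm (A *m X) <= frob_norm A * frob_norm X.
Proof.
apply: le_frob_norm; first exact: frob_norm_ge0.
rewrite -(frob_norm_tr A) !frob_norm_sum_col mulr_suml.
rewrite -frob_norm_sum_col frob_norm_sqr mxtrace_trmx_mul.
apply: ler_sum => i _; rewrite mulr_sumr; apply: ler_sum => j _.
rewrite -expr2 -exprMn.
have -> : (A *m X) i j = \tr ((col i A^T)^T *m col j X).
  by rewrite trace_mx11 !mxE; apply: eq_bigr => l _; rewrite !mxE.
(* [frob_norm_CS] bounds the trace from above only; using it with both signs bounds the absolute
   value. *)
have h1 := frob_norm_CS (col i A^T) (col j X).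
have h2 := frob_norm_CS (- col i A^T) (col j X).
rewrite -[leLHS]real_normK ?num_real // ler_pXn2r ?nnegrE ?mulr_ge0 ?frob_norm_ge0 //.
rewrite ler_norml h1 andbT lerNl.
by rewrite raddfN mulNmx raddfN frob_normN in h2.
Qed.

Lemma spec_norm_ub m n (A : 'M[R]_(m, n)) (x : 'cV[R]_n) :
  frob_norm x <= 1 -> frob_norm (A *m x) <= spec_norm A.
Proof.
move=> x1; apply: ub_le_sup; last by exists x.
(* [sup] is an upper bound only if the set is bounded, which the Frobenius norm ensures. *)
exists (frob_norm A) => _ [y /= y1 <-].
by rewrite (le_trans (frob_norm_mul _ _)) // ler_piMr // frob_norm_ge0.
Qed.

Lemma spec_norm_ge0 m n (A : 'M[R]_(m, n)) : 0 <= spec_norm A.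
Proof.
apply: le_trans (spec_norm_ub A (x := 0) _); first exact: frob_norm_ge0.
by rewrite frob_norm0.
Qed.

(** Vectors are normalized; for matrices the squared bounds are summed over the columns. *)
Lemma op_le_spec_norm m n (A : 'M[R]_(m, n)) : op_le (spec_norm A) A.
Proof.
have colbound (x : 'cV[R]_n) : frob_norm (A *m x) <= spec_norm A * frob_norm x.
  have [x0|x0] := eqVneq (frob_norm x) 0.
    by rewrite (frob_norm_eq0 x0) mulmx0 !frob_norm0 mulr0.
  have xp : 0 < frob_norm x by rewrite lt_def x0 frob_norm_ge0.
  have xv : 0 <= (frob_norm x)^-1 by rewrite invr_ge0 ltW.
  rewrite mulrC -ler_pdivrMl // -frob_normZ // scalemxAr.
  by apply: spec_norm_ub; rewrite frob_normZ // mulVf.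
move=> k X; apply: le_frob_norm; first exact: spec_norm_ge0.
rewrite !frob_norm_sum_col mulr_sumr; apply: ler_sum => j _.
rewrite colE -mulmxA -colE -exprMn.
by rewrite ler_pXn2r ?nnegrE ?mulr_ge0 ?frob_norm_ge0 ?spec_norm_ge0.
Qed.

End OperatorBound.

(** * Lower bounds on singular values and the Frobenius distance of matrices of rank at most n *)

Section SingularValues.
Variable R : realType.
Implicit Types m n k : nat.

(** The lower bound makes the square matrix V^T E injective, hence invertible. For y with V^T E y =
    e_j, the norm of L E y is s_j, while |y| >= 1 because V^T and E do not increase norms; so s_j >=
    c |y| >= c. *)
Lemma svd_lower_bound m N n (L : 'M[R]_(m, N)) U (s : 'rV[R]_n) V
    (E : 'M[R]_(N, n)) (c : R) :
  is_svd L U s V -> E^T *m E = 1%:M -> 0 < c ->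
  (forall y : 'cV[R]_n, c * frob_norm y <= frob_norm (L *m E *m y)) ->
  forall j, c <= s 0 j.
Proof.
move=> [LE UU VV s0 _] EE c0 Ebound j.
have LEy y : L *m E *m y = U *m (diag_mx s *m (V^T *m E *m y)) :> 'cV_m.
  by rewrite LE !mulmxA.
have VEunit : V^T *m E \in unitmx.
  rewrite -unitmx_tr -row_free_unit; apply: inj_row_free => v.
  move=> /(congr1 trmx); rewrite trmx_mul trmxK trmx0 => VEv.
  apply: trmx_inj; rewrite trmx0; apply: frob_norm_eq0.
  have := Ebound v^T; rewrite LEy VEv !mulmx0 frob_norm0.
  by rewrite pmulr_rle0 // => ?; apply/eqP; rewrite eq_le frob_norm_ge0 andbT.
pose y := invmx (V^T *m E) *m (delta_mx j 0 : 'cV[R]_n).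
have VEy : V^T *m E *m y = delta_mx j 0 by rewrite mulKVmx.
have delta1 : frob_norm (delta_mx j 0 : 'cV[R]_n) = 1.
  apply/eqP; rewrite -(@eqrXn2 _ 2) ?frob_norm_ge0 // frob_norm_sqr.
  by rewrite trmx_delta -rowE trace_mx11 !mxE !eqxx expr1n.
have VTle : op_le 1 V^T by apply: op_le_tr => //; exact: op_le_isometry.
have y1 : 1 <= frob_norm y.
  rewrite -delta1 -VEy -mulmxA (le_trans (VTle _ _)) // mul1r.
  by rewrite frob_norm_isometry.
have := Ebound y; rewrite LEy VEy frob_norm_isometry //.
have -> : diag_mx s *m delta_mx j 0 = s 0 j *: delta_mx j (0 : 'I_1).
  apply/matrixP => a b; rewrite mul_diag_mx !mxE.
  by have [->|_] := eqVneq a j; rewrite ?mulr0.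
rewrite frob_normZ // delta1 mulr1; apply: le_trans.
by rewrite ler_pMr.
Qed.

(** E consists of the first n right singular vectors of L. *)
Lemma singular_value_subspace m N n (L : 'M[R]_(m, N)) :
  0 < singular_value n L ->
  exists2 E : 'M[R]_(N, n), E^T *m E = 1%:M &
    forall y : 'cV[R]_n,
      singular_value n L * frob_norm y <= frob_norm (L *m E *m y).
Proof.
case: n => [|k]; rewrite /singular_value ?ltxx //.
case: insubP => [i _ ik|]; rewrite ?ltxx //.
rewrite /singular_values.
(* Positivity excludes the default value of [xget], so t belongs to an actual SVD of L. The index i
   has value n - 1. *)
case: xgetP => [t _ [U [V]] [LE UU VV t0 tmono]|_]; last by rewrite mxE ltxx.
move=> ti0; have kmin : (k.+1 <= minn m N)%N by rewrite -ik ltn_ord.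
pose f := widen_ord kmin.
have f_inj : injective f by move=> a b /(congr1 val) /= /val_inj.
pose J : 'M[R]_(minn m N, k.+1) := colsub f 1%:M.
have JJ : J^T *m J = 1%:M.
  apply/matrixP => a b; rewrite !mxE (bigD1 (f b)) //= big1 => [|l lb].
    by rewrite !mxE eqxx mulr1 addr0 (inj_eq f_inj) eq_sym.
  by rewrite !mxE (negbTE lb) mulr0.
exists (V *m J); first by rewrite trmx_mul mulmxA -(mulmxA J^T) VV mulmx1.
move=> y; rewrite LE.
have -> : U *m diag_mx t *m V^T *m (V *m J) *m y = U *m (diag_mx t *m (J *m y)).
  by rewrite !mulmxA -(mulmxA _ V^T) VV mulmx1.
rewrite frob_norm_isometry // -(frob_norm_isometry y JJ).
set z := J *m y.
(* Only the first n coordinates of z survive, and there monotonicity gives t_a >= t_i. *)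
have z0 (a : 'I_(minn m N)) : (i < a)%N -> z a 0 = 0.
  move=> ia; rewrite mxE big1 // => b _; rewrite !mxE.
  have /negbTE -> : a != f b; last by rewrite mul0r.
  apply: contraTneq ia => ->; rewrite ik /= -leqNgt -ltnS; exact: ltn_ord.
move: {y}z z0 => z z0; rewrite -(frob_normZ _ (ltW ti0)) ler_wsqrtr //.
apply: ler_sum => a _.
apply: ler_sum => b _; rewrite ord1 mul_diag_mx !mxE !exprMn.
have [ia|ai] := ltnP i a; first by rewrite z0 // expr0n /= !mulr0.
rewrite ler_wpM2r ?sqr_ge0 // ler_pXn2r ?nnegrE ?t0 ?(ltW ti0) //.
exact: tmono.
Qed.

(** Split X^T by the projection P = V V^T onto a space containing the rows of L. The part P X^T is
    controlled by X V; the other part equals -(1 - P) Lh^T, hence is unchanged by Uh Uh^T and is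
    controlled by X^T Uh. Both V and Uh have n orthonormal columns, so each part contributes n
    e^2. *)
Lemma frob_norm_svd_diff m N n (L Lh : 'M[R]_(m, N)) U Uh (s sh : 'rV[R]_n) V Vh :
  is_svd L U s V -> is_svd Lh Uh sh Vh ->
  frob_norm (L - Lh) ^+ 2 <= 2 * n%:R * spec_norm (L - Lh) ^+ 2.
Proof.
move=> [LE _ VV _ _] [LhE UUh _ _ _]; set X := L - Lh; set e := spec_norm X.
have e0 : 0 <= e by exact: spec_norm_ge0.
have X_le : op_le e X by exact: op_le_spec_norm.
pose P := V *m V^T.
have PP : P *m P = P by rewrite /P mulmxA -(mulmxA V) VV mulmx1.
have Pt : P^T = P by rewrite trmx_mul trmxK.
rewrite -frob_norm_tr (frob_norm_proj _ Pt PP).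
have LP : (1%:M - P) *m L^T = 0.
  rewrite LE !trmx_mul trmxK mulmxBl mul1mx.
  by rewrite /P !mulmxA -(mulmxA V V^T V) VV mulmx1 subrr.
have compl_X : (1%:M - P) *m X^T = - ((1%:M - P) *m Lh^T).
  by rewrite /X trmxB mulmxBr LP sub0r.
have LhUh : Lh^T *m Uh *m Uh^T = Lh^T.
  by rewrite LhE !trmx_mul trmxK -!mulmxA (mulmxA Uh^T) UUh mul1mx.
have {compl_X LhUh} -> : (1%:M - P) *m X^T = (1%:M - P) *m (X^T *m Uh) *m Uh^T.
  by rewrite mulmxA compl_X !mulNmx -!mulmxA (mulmxA Lh^T) LhUh.
have sqr_bound k (U0 : 'M[R]_(k, n)) x : U0^T *m U0 = 1%:M ->
    0 <= x -> x <= e * frob_norm U0 -> x ^+ 2 <= n%:R * e ^+ 2.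
  move=> UU x0 xe; rewrite -(frob_norm_orthonormal UU) mulrC -exprMn.
  by rewrite ler_pXn2r ?nnegrE ?mulr_ge0 ?frob_norm_ge0.
rewrite -mulrA mulr2n mulrDl !mul1r lerD //.
  apply: (sqr_bound _ V) => //; first exact: frob_norm_ge0.
  rewrite /P -mulmxA frob_norm_isometry // -trmx_mul frob_norm_tr.
  exact: X_le.
apply: (sqr_bound _ Uh) => //; first exact: frob_norm_ge0.
rewrite -frob_norm_tr trmx_mul trmxK frob_norm_isometry // frob_norm_tr.
rewrite (le_trans (frob_norm_proj_compl_le _ Pt PP)) //.
exact: (op_le_tr e0).
Qed.

End SingularValues.

(** * The Procrustes estimate *)

Section Procrustes.
Variable R : realType.
Implicit Types m n k : nat.

Lemma mxtrace_conj_ge0 n (P : 'M[R]_n) :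
  (forall v : 'cV[R]_n, 0 <= \tr (v^T *m P *m v)) ->
  forall k (X : 'M[R]_(k, n)), 0 <= \tr (X *m P *m X^T).
Proof.
move=> psd k X; apply: sumr_ge0 => i _.
have := psd (row i X)^T; rewrite trmxK trace_mx11.
rewrite -row_mul; congr (0 <= _); rewrite !mxE.
by apply: eq_bigr => j _; rewrite !mxE.
Qed.

Lemma frob_norm_gram_sub m n (W Z : 'M[R]_(m, n)) :
  frob_norm (W *m W^T - Z *m Z^T) ^+ 2 =
  \tr (W^T *m W *m (W^T *m W)) + \tr (Z^T *m Z *m (Z^T *m Z))
  - 2 * \tr ((Z^T *m W)^T *m (Z^T *m W)).
Proof.
rewrite frob_norm_sqr trmxB !trmx_mul !trmxK mulmxBl !mulmxBr !mxtraceB.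
have gram (A B : 'M[R]_(m, n)) :
    \tr (A *m A^T *m (B *m B^T)) = \tr ((B^T *m A) *m (A^T *m B)).
  by rewrite !mulmxA mxtrace_mulC !mulmxA.
rewrite !gram (mxtrace_mulC (Z^T *m W)); ring.
Qed.

(** Alignment makes p = Y^T W symmetric, so everything reduces to traces of products of the
    symmetric matrices p, a, b and d = b - 2 p + a. *)
Lemma procrustes_bound m n (W Y : 'M[R]_(m, n)) (c : R) :
  (Y^T *m W)^T = Y^T *m W ->
  (forall v : 'cV[R]_n, 0 <= \tr (v^T *m (Y^T *m W) *m v)) ->
  (forall k (X : 'M[R]_(k, n)),
     c * frob_norm X ^+ 2 <= \tr (X *m (W^T *m W) *m X^T)) ->
  c / 2 * frob_norm (Y - W) ^+ 2 <= frob_norm (W *m W^T - Y *m Y^T) ^+ 2.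
Proof.
rewrite frob_norm_gram_sub; set p := Y^T *m W; set a := W^T *m W.
set b := Y^T *m Y => psym ppsd hc.
have WY : W^T *m Y = p by rewrite -psym trmx_mul trmxK.
have a_sym : a^T = a by rewrite trmx_mul trmxK.
pose d := (Y - W)^T *m (Y - W).
have dE : d = b - p - p + a.
  rewrite /d trmxB mulmxBl !mulmxBr WY -/p -/a -/b opprB addrA.
  by rewrite addrAC [RHS]addrAC [b - p + a - p]addrAC.
(* [hd] says tr (a d) >= c |Y - W|^2 and [hp] says tr (p d) >= 0. The final c / 2 comes from the
   coefficient 2 t - 2 = 1 / 2 of tr (a d). *)
have hd := hc _ (Y - W)%R; rewrite -mulmxA mxtrace_mulC -mulmxA -/d in hd.
have hp := mxtrace_conj_ge0 ppsd (Y - W).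
rewrite -mulmxA mxtrace_mulC -mulmxA -/d in hp.
(* With q := p - a, the right-hand side is
   tr (d + t q)^2 + (2 - t^2) tr q^2 + (4 - 2 t) tr (p d) + (2 t - 2) tr (a d)
   for every t; t = 5/4 makes all the coefficients nonnegative. *)
have h1 := mxtrace_trmx_mul_ge0 (d + (5 / 4) *: (p - a)).
have h2 := mxtrace_trmx_mul_ge0 (p - a).
have q_sym : (p - a)^T = p - a by rewrite trmxB psym a_sym.
have d_sym : d^T = d by rewrite /d trmx_mul trmxK.
clearbody d; rewrite trmxD trmx_scale q_sym d_sym mulmxDl !mulmxDr in h1.
rewrite -!scalemxAl -!scalemxAr !mxtraceD !mxtraceZ in h1.
rewrite q_sym in h2; rewrite psym.
have expand := (mulmxDl, mulmxDr, mulNmx, mulmxN, mxtraceD, mxtraceN).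
move: h1 h2 hp hd; rewrite dE !expand.
rewrite (mxtrace_mulC p a) (mxtrace_mulC p b) (mxtrace_mulC b a).
lra.
Qed.

(** Balancedness gives W^T W = 2 g and Z^T Z = 2 h, while Z^T W = K1 + K2. The right side then
    exceeds the left by exactly 2 |K1 - K2|^2. *)
Lemma frob_norm_gram_balanced m k n (O Oh : 'M[R]_(m, n)) (Q Qh : 'M[R]_(n, k)) :
  O^T *m O = Q *m Q^T -> Oh^T *m Oh = Qh *m Qh^T ->
  let W := col_mx O Q^T in let Z := col_mx Oh Qh^T in
  frob_norm (W *m W^T - Z *m Z^T) ^+ 2 <= 4 * frob_norm (O *m Q - Oh *m Qh) ^+ 2.
Proof.
move=> bal balh; rewrite /= frob_norm_gram_sub.
have gram A B C D :
    (@col_mx R m k n A B^T)^T *m col_mx C D^T = A^T *m C + B *m D^T.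
  by rewrite tr_col_mx mul_row_col trmxK.
rewrite !gram bal balh; set g := Q *m Q^T; set h := Qh *m Qh^T.
set K1 := Oh^T *m O; set K2 := Qh *m Q^T.
have -> : frob_norm (O *m Q - Oh *m Qh) ^+ 2 =
    \tr (g *m g) + \tr (h *m h) - 2 * \tr (K1^T *m K2).
  rewrite frob_norm_sqr trmxB (trmx_mul O) (trmx_mul Oh).
  rewrite mulmxBl !mulmxBr !mxtraceB.
  have cross (A C : 'M[R]_(m, n)) (B D : 'M[R]_(n, k)) :
      \tr (B^T *m A^T *m (C *m D)) = \tr (A^T *m C *m (D *m B^T)).
    by rewrite -!mulmxA mxtrace_mulC !mulmxA.
  have K1t : K1^T = O^T *m Oh by rewrite trmx_mul trmxK.
  have K2t : K2^T = Q *m Qh^T by rewrite trmx_mul trmxK.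
  rewrite !cross bal balh -K1t -K2t -/g -/h -/K1 -/K2.
  rewrite (mxtrace_mulC K1) (mxtrace_trmx_mulC K2); ring.
have := mxtrace_trmx_mul_ge0 (K1 - K2).
have expand := (mulmxDl, mulmxDr, mulNmx, mulmxN, mxtraceD, mxtraceN).
rewrite !(trmxB, trmxD) !expand (mxtrace_trmx_mulC K2 K1).
lra.
Qed.

(** Stacking lets one S align both factors at once: it is the orthogonal polar factor of Z^T W, and
    Z S has blocks Oh S and (S^T Qh)^T. *)
Lemma balanced_alignment m k n (O Oh : 'M[R]_(m, n)) (Q Qh : 'M[R]_(n, k))
    (c : R) :
  O^T *m O = Q *m Q^T -> Oh^T *m Oh = Qh *m Qh^T ->
  (forall l (X : 'M[R]_(l, n)),
     c * frob_norm X ^+ 2 <= \tr (X *m (O^T *m O) *m X^T)) ->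
  exists2 S, orthogonal_mx S &
    c * (frob_norm (O - Oh *m S) ^+ 2 + frob_norm (Q - S^T *m Qh) ^+ 2) <=
    4 * frob_norm (O *m Q - Oh *m Qh) ^+ 2.
Proof.
move=> bal balh hc; set W := col_mx O Q^T; set Z := col_mx Oh Qh^T.
have [S [So ZWsym ZWpsd]] := polar (Z^T *m W); exists S => //.
have ZWE : (Z *m S)^T *m W = S^T *m (Z^T *m W) by rewrite trmx_mul mulmxA.
apply: le_trans (frob_norm_gram_balanced bal balh); rewrite -/W -/Z.
have -> : Z *m Z^T = Z *m S *m (Z *m S)^T.
  by rewrite trmx_mul mulmxA -(mulmxA Z) So.2 mulmx1.
(* Since W^T W = 2 O^T O, the constant doubles, which absorbs the 1 / 2 of [procrustes_bound]. *)
have c2 l (X : 'M[R]_(l, n)) :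
    2 * c * frob_norm X ^+ 2 <= \tr (X *m (W^T *m W) *m X^T).
  rewrite tr_col_mx trmxK mul_row_col -bal mulmxDr mulmxDl mxtraceD.
  have := hc _ X; lra.
rewrite -ZWE in ZWsym ZWpsd; have := procrustes_bound ZWsym ZWpsd c2.
have -> : Z *m S - W = - col_mx (O - Oh *m S) (Q - S^T *m Qh)^T.
  by rewrite mul_col_mx trmxB trmx_mul trmxK !opp_col_mx add_col_mx !opprB.
rewrite frob_normN frob_norm_col_mx frob_norm_tr; apply: le_trans.
by rewrite le_eqVlt; apply/orP; left; apply/eqP; field.
Qed.

End Procrustes.

(** * Perturbation of pseudoinverses *)

Section PseudoInverse.
Variable R : realType.
Implicit Types m n k : nat.

Lemma is_pinv_unique m n (A : 'M[R]_(m, n)) X Y :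
  is_pinv A X -> is_pinv A Y -> X = Y.
Proof.
move=> [AXA XAX AXs XAs] [AYA YAY AYs YAs].
have AXY : A *m X = A *m Y.
  rewrite -[in LHS]AYA -mulmxA -AXs -AYs -trmx_mul.
  by rewrite mulmxA AXA AYs.
have XYA : X *m A = Y *m A.
  rewrite -[in LHS]AYA mulmxA mulmxA -mulmxA -XAs -YAs -trmx_mul.
  by rewrite -mulmxA (mulmxA A) AXA YAs.
by rewrite -XAX XYA -mulmxA AXY mulmxA YAY.
Qed.

(* Unqualified, pinv is the inverse on the image of a function from
   mathcomp-classical. *)
Lemma pinv_eq m n (A : 'M[R]_(m, n)) X : is_pinv A X -> Defs.pinv A = X.
Proof.
move=> AX; apply: (is_pinv_unique (A := A)) => //.
have : exists Y, [set Y | is_pinv A Y]%classic Y by exists X.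
exact: xgetPex.
Qed.

Lemma is_pinv_tr m n (A : 'M[R]_(m, n)) X : is_pinv A X -> is_pinv A^T X^T.
Proof.
by move=> [h1 h2 h3 h4]; split; rewrite -!trmx_mul ?mulmxA ?h1 ?h2 ?h3 ?h4.
Qed.

Lemma is_pinv_orth m n (A : 'M[R]_(m, n)) X (S : 'M[R]_n) :
  orthogonal_mx S -> is_pinv A X -> is_pinv (A *m S) (S^T *m X).
Proof.
move=> [StS SSt] [AXA XAX AXs XAs].
have ASX : A *m S *m (S^T *m X) = A *m X by rewrite mulmxA -(mulmxA A) SSt mulmx1.
split.
- by rewrite ASX mulmxA AXA.
- by rewrite -mulmxA ASX -mulmxA (mulmxA X) XAX.
- by rewrite ASX.
- by rewrite -mulmxA (mulmxA X) !trmx_mul trmxK -trmx_mul XAs mulmxA.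
Qed.

(* Wedin's identity, with E := A - B. *)
Lemma pinv_perturb m n (A B : 'M[R]_(m, n)) (X Y : 'M[R]_(n, m)) :
  is_pinv A X -> X *m A = 1%:M -> is_pinv B Y ->
  let E := A - B in
  X - Y = X *m (X^T *m (E^T *m (1%:M - B *m Y))) - X *m (E *m Y).
Proof.
move=> [AXA XAX AXs XAs] XA1 [BYB YBY BYs YBs] E.
have BtP : B^T *m (1%:M - B *m Y) = 0.
  by rewrite mulmxBr mulmx1 -BYs -trmx_mul BYB subrr.
rewrite /E trmxB mulmxBl BtP subr0 !mulmxA -(mulmxA X X^T) -trmx_mul AXs.
rewrite mulmxA XAX mulmxBr mulmx1 mulmxBr XA1 mulmxBl mul1mx.
by rewrite opprB addrA mulmxA subrK.
Qed.

(** The two terms of Wedin's identity contribute a^2 and a b; the projection 1 - B Y does not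
    increase the norm. *)
Lemma frob_norm_pinv_sub m n (A B : 'M[R]_(m, n)) (X Y : 'M[R]_(n, m)) (a b : R) :
  is_pinv A X -> X *m A = 1%:M -> is_pinv B Y ->
  0 <= a -> 0 <= b -> op_le a X -> op_le b Y ->
  frob_norm (X - Y) <= a * (a + b) * frob_norm (A - B).
Proof.
move=> AX XA1 BY a0 b0 Xa Yb; rewrite (pinv_perturb AX XA1 BY).
rewrite (le_trans (frob_norm_triangle _ _)) // frob_normN mulrDr mulrDl lerD //.
  rewrite (le_trans (Xa _ _)) // -mulrA ler_wpM2l //.
  rewrite (le_trans (op_le_tr a0 Xa _)) // ler_wpM2l //.
  case: BY => BYB YBY BYs _; rewrite -frob_norm_tr trmx_mul trmxK trmxB trmx1 BYs.
  by apply: frob_norm_proj_compl_le; rewrite // mulmxA BYB.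
rewrite (le_trans (Xa _ _)) // -mulrA ler_wpM2l // mulrC.
exact: op_leMr.
Qed.

(** * Balanced SVD factors and perturbation of a triple product *)

Lemma op_le_diag n (d : 'rV[R]_n) (c : R) :
  0 <= c -> (forall j, `|d 0 j| <= c) -> op_le c (diag_mx d).
Proof.
move=> c0 dc k X; rewrite -frob_normZ // ler_wsqrtr //.
apply: ler_sum => i _; apply: ler_sum => j _.
rewrite mul_diag_mx !mxE !exprMn ler_wpM2r ?sqr_ge0 //.
by rewrite -[leLHS]real_normK ?num_real // ler_pXn2r ?nnegrE.
Qed.

Lemma svd_factor_gram m n (U : 'M[R]_(m, n)) (s : 'rV[R]_n) :
  U^T *m U = 1%:M -> (forall j, 0 <= s 0 j) ->
  let A := U *m diag_mx (map_mx Num.sqrt s) in A^T *m A = diag_mx s.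
Proof.
move=> UU s0 /=; rewrite trmx_mul mulmxA -(mulmxA _ U^T) UU mulmx1 tr_diag_mx.
rewrite mulmx_diag; congr diag_mx; apply/rowP => j.
by rewrite !mxE -expr2 sqr_sqrtr.
Qed.

(** The pseudoinverse is explicitly diag(s)^(-1/2) U^T, a left inverse. *)
Lemma svd_factor_pinv m n (U : 'M[R]_(m, n)) (s : 'rV[R]_n) (c : R) :
  U^T *m U = 1%:M -> 0 < c -> (forall j, c <= s 0 j) ->
  let A := U *m diag_mx (map_mx Num.sqrt s) in
  [/\ is_pinv A (Defs.pinv A), Defs.pinv A *m A = 1%:M &
      op_le (Num.sqrt c)^-1 (Defs.pinv A)].
Proof.
move=> UU c0 cs A; pose r : 'rV[R]_n := map_mx (fun x => (Num.sqrt x)^-1) s.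
have sr (j : 'I_n) : Num.sqrt (s 0 j) != 0.
  by rewrite gt_eqF // sqrtr_gt0 (lt_le_trans c0).
have rs : diag_mx r *m diag_mx (map_mx Num.sqrt s) = 1%:M.
  rewrite mulmx_diag -diag_const_mx; congr diag_mx; apply/rowP => j.
  by rewrite !mxE mulVf.
have sr1 : diag_mx (map_mx Num.sqrt s) *m diag_mx r = 1%:M.
  by rewrite -rs; exact: diag_mxC.
pose X := diag_mx r *m U^T.
have XA : X *m A = 1%:M by rewrite /X mulmxA -(mulmxA _ U^T) UU mulmx1.
have AX : A *m X = U *m U^T by rewrite /X mulmxA -(mulmxA U) sr1 mulmx1.
have pX : is_pinv A X.
  split; rewrite ?XA ?trmx1 ?mul1mx //.
    by rewrite -mulmxA XA mulmx1.
  by rewrite AX trmx_mul trmxK.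
rewrite (pinv_eq pX); split=> //.
rewrite /X -[_^-1]mulr1; apply: op_leM; first by rewrite invr_ge0 sqrtr_ge0.
  apply: op_le_diag => [|j]; first by rewrite invr_ge0 sqrtr_ge0.
  rewrite mxE ger0_norm ?invr_ge0 ?sqrtr_ge0 //.
  by rewrite lef_pV2 ?posrE ?sqrtr_gt0 ?(lt_le_trans c0) // ler_wsqrtr.
by apply: op_le_tr => //; exact: op_le_isometry.
Qed.

(** Telescope, changing one factor at a time. H - K is known only in operator norm, so the middle
    term takes its Frobenius norm from Z. *)
Lemma frob_norm_triple_sub m n k l (X Y : 'M[R]_(n, m)) (H K : 'M[R]_(m, k))
    (Z T : 'M[R]_(k, l)) (x y z h e d1 d2 f : R) :
  0 <= y -> 0 <= z -> 0 <= h -> 0 <= e ->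
  op_le y Y -> op_le z Z -> op_le h H -> op_le e (H - K) ->
  frob_norm (X - Y) <= d1 -> frob_norm (Z - T) <= d2 -> frob_norm Z <= f ->
  frob_norm (X *m H *m Z - Y *m K *m T) <=
  d1 * h * z + y * e * f + y * (h + e) * d2.
Proof.
move=> y0 z0 h0 e0 hY hZ hH hE hd1 hd2 hf.
have hK : op_le (h + e) K.
  by rewrite -[K](subKr H); apply: op_leD => //; exact: op_leN.
have -> : X *m H *m Z - Y *m K *m T =
    (X - Y) *m H *m Z + Y *m (H - K) *m Z + Y *m K *m (Z - T).
  by rewrite !(mulmxBl, mulmxBr) !addrA !subrK.
rewrite (le_trans (frob_norm_triangle _ _)) // lerD //.
  rewrite (le_trans (frob_norm_triangle _ _)) // lerD //.
    rewrite (le_trans (op_leMr _ z0 hZ)) // ler_wpM2r //.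
    by rewrite (le_trans (op_leMr _ h0 hH)) // ler_wpM2r.
  rewrite (le_trans (op_leM y0 hY hE _)) // ler_wpM2l // mulr_ge0 //.
by rewrite (le_trans (op_leM y0 hY hK _)) // ler_wpM2l // mulr_ge0 // addr_ge0.
Qed.

End PseudoInverse.

(** * Proof of the theorem *)

Lemma frob_norm_submxcol (R : realType) q (p_ : 'I_q -> nat) n
    (A : 'M[R]_(\sum_i p_ i, n)) i :
  frob_norm (submxcol A i) <= frob_norm A.
Proof.
exact/frob_norm_rowsub/inc_inj/tagnat.le_Rank.
Qed.

Lemma frob_norm_submxrow (R : realType) q (p_ : 'I_q -> nat) n
    (A : 'M[R]_(n, \sum_i p_ i)) i :
  frob_norm (submxrow A i) <= frob_norm A.
Proof. by rewrite -frob_norm_tr tr_submxrow -(frob_norm_tr A) frob_norm_submxcol. Qed.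

Lemma mxtrace_diag_lower_bound (R : realType) n k (s : 'rV[R]_n) (c : R)
    (X : 'M[R]_(k, n)) :
  (forall j, c <= s 0 j) ->
  c * frob_norm X ^+ 2 <= \tr (X *m diag_mx s *m X^T).
Proof.
move=> cs; rewrite -frob_norm_tr frob_norm_sqr mxtrace_trmx_mul.
rewrite -[X *m _]trmxK mxtrace_trmx_mul mulr_sumr.
apply: ler_sum => j _; rewrite mulr_sumr; apply: ler_sum => i _.
rewrite mul_mx_diag !mxE mulrAC (mulrC (X i j * _)).
by rewrite ler_wpM2r // -expr2 sqr_ge0.
Qed.

(** The rational 3 / 2 replaces the square root of 2. *)
Lemma half_sqrt_bound (R : realType) (c : R) : 0 < c ->
  (Num.sqrt (c / 2))^-1 <= 3 / 2 * (Num.sqrt c)^-1.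
Proof.
move=> c0; have s0 : 0 < Num.sqrt c by rewrite sqrtr_gt0.
have h0 : 0 < Num.sqrt (c / 2) by rewrite sqrtr_gt0 divr_gt0.
rewrite ler_pdivlMr // ler_pdivrMl //.
rewrite -(@ler_pXn2r _ 2) ?nnegrE ?mulr_ge0 ?sqrtr_ge0 ?invr_ge0 //.
rewrite exprMn !sqr_sqrtr; lra.
Qed.

(** The facts on Q are stated for Q^T, whose pseudoinverse is a left inverse, as
    [frob_norm_pinv_sub] requires. *)
Lemma svd_factors (R : realType) m k n (L : 'M[R]_(m, k)) U (s : 'rV[R]_n) V
    (c : R) :
  is_svd L U s V -> 0 < c -> (forall j, c <= s 0 j) ->
  let O := U *m diag_mx (map_mx Num.sqrt s) in
  let Q := diag_mx (map_mx Num.sqrt s) *m V^T in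
  [/\ L = O *m Q, O^T *m O = diag_mx s, Q *m Q^T = diag_mx s,
      [/\ is_pinv O (Defs.pinv O), Defs.pinv O *m O = 1%:M &
          op_le (Num.sqrt c)^-1 (Defs.pinv O)] &
      [/\ is_pinv Q^T (Defs.pinv Q)^T, (Defs.pinv Q)^T *m Q^T = 1%:M &
          op_le (Num.sqrt c)^-1 (Defs.pinv Q)^T]].
Proof.
move=> [LE UU VV s0 _] c0 cs O Q.
have QtE : Q^T = V *m diag_mx (map_mx Num.sqrt s).
  by rewrite trmx_mul trmxK tr_diag_mx.
have [pQ pQ1 pQc] := svd_factor_pinv VV c0 cs.
have pinvQ : (Defs.pinv Q)^T = Defs.pinv Q^T.
  rewrite -QtE in pQ; have /is_pinv_tr := pQ; rewrite trmxK => h.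
  by rewrite (pinv_eq h) trmxK.
split.
- rewrite LE /O /Q !mulmxA -(mulmxA U (diag_mx (map_mx _ _))) mulmx_diag.
  congr (U *m diag_mx _ *m _).
  by apply/rowP => j; rewrite !mxE -expr2 sqr_sqrtr.
- exact: svd_factor_gram.
- by rewrite -{1}(trmxK Q) QtE; exact: svd_factor_gram.
- exact: svd_factor_pinv.
- by rewrite pinvQ QtE.
Qed.

(** Here a^2 = 1 / s, a + b = 5 a / 2 and x a = sqrt 5 sqrt n sqrt (e / s). The outer terms have
    coefficients 5 / 2 and 15 / 4, and (25 / 4) sqrt 5 is just below 14. *)
Lemma ho_kalman_constant (R : realType) (n : nat) (e s h d : R) :
  0 <= e -> 0 < s -> 0 <= h -> 0 <= d ->
  let a := (Num.sqrt s)^-1 in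
  let b := 3 / 2 * a in
  let x := Num.sqrt (5 * n%:R * e) in
  a * (a + b) * x * h * a + b * d * (a * Num.sqrt n%:R)
    + b * (h + d) * (a * (a + b) * x) <=
  14 * Num.sqrt n%:R / s * (Num.sqrt (e / s) * (h + d) + d).
Proof.
move=> e0 s0 h0 d0 /=; set a := (Num.sqrt s)^-1; set b := 3 / 2 * a.
set x := Num.sqrt (5 * n%:R * e).
have a0 : 0 <= a by rewrite invr_ge0 sqrtr_ge0.
have as2 : a ^+ 2 = s^-1 by rewrite exprVn sqr_sqrtr // ltW.
set t := Num.sqrt (e / s); set r := Num.sqrt n%:R.
have t0 : 0 <= t by exact: sqrtr_ge0.
have r0 : 0 <= r by exact: sqrtr_ge0.
have xa : x * a = Num.sqrt 5 * r * t.
  by rewrite /x /a /t /r -sqrtrV ?(ltW s0) // -!sqrtrM ?mulr_ge0 // !mulrA.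
have five : 25 / 4 * Num.sqrt 5 <= 14 :> R.
  have f0 : 0 <= Num.sqrt 5 :> R by exact: sqrtr_ge0.
  have f2 : Num.sqrt 5 ^+ 2 = 5 :> R by rewrite sqr_sqrtr.
  nra.
have -> : a * (a + b) * x * h * a + b * d * (a * r) + b * (h + d) * (a * (a + b) * x)
    = a ^+ 2 * (5 / 2 * (x * a) * h + 3 / 2 * d * r + 15 / 4 * (x * a) * (h + d)).
  by rewrite /b; field.
rewrite as2 xa (mulrC (14 * r)) -[leRHS]mulrA.
have sv : 0 <= s^-1 by rewrite invr_ge0 ltW.
rewrite ler_wpM2l //.
have rt : 0 <= r * t by exact: mulr_ge0.
have rd : 0 <= r * d by exact: mulr_ge0.
have main : 25 / 4 * Num.sqrt 5 * (r * t * (h + d)) <= 14 * (r * t * (h + d)).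
  by rewrite ler_wpM2r // mulr_ge0 // addr_ge0.
have low : 0 <= 5 / 2 * Num.sqrt 5 * (r * t * d).
  by rewrite mulr_ge0 ?mulr_ge0 ?sqrtr_ge0 ?invr_ge0.
lra.
Qed.

Theorem theorem5p3 (R : realType) (n m p T1 T2 : nat)
    (hT1 : (0 < T1)%N) (hT2 : (0 < T2)%N)
    (A : 'M[R]_n) (B : 'M[R]_(n, p)) (C : 'M[R]_(m, n)) (D : 'M[R]_(m, p))
    (hctrl : controllable A B) (hobs : observable C A)
    (G Ghat : 'M[R]_(m, blk (T1 + T2).+1 p))
    (hG : G = markov (T1 + T2).+1 A B C D)
    (hrank : \rank (hankel_minus G) = n)
    (L Lhat : 'M[R]_(blk T1 m, blk T2 p))
    (O Ohat : 'M[R]_(blk T1 m, n)) (Q Qhat : 'M[R]_(n, blk T2 p))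
    (Abar Ahat : 'M[R]_n) (Bbar Bhat : 'M[R]_(n, p)) (Cbar Chat : 'M[R]_(m, n))
    (hrun : ho_kalman hT1 hT2 G L O Q Abar Bbar Cbar)
    (hrunhat : ho_kalman hT1 hT2 Ghat Lhat Ohat Qhat Ahat Bhat Chat)
    (hsigma : 0 < singular_value n L)
    (hclose : spec_norm (L - Lhat) <= singular_value n L / 2) :
  let Hp := hankel_plus G in
  let Hphat := hankel_plus Ghat in
  let eps := spec_norm (L - Lhat) in
  let sigma_min := singular_value n L in
  exists S : 'M[R]_n,
    [/\ orthogonal_mx S,
        frob_norm (Cbar - Chat *m S) <= frob_norm (O - Ohat *m S)
          <= Num.sqrt (5 * n%:R * eps),
        frob_norm (Bbar - S^T *m Bhat) <= frob_norm (Q - S^T *m Qhat)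
          <= Num.sqrt (5 * n%:R * eps)
      & frob_norm (Abar - S^T *m Ahat *m S) <=
        14 * Num.sqrt n%:R / sigma_min *
          (Num.sqrt (eps / sigma_min)
             * (spec_norm Hp + spec_norm (Hp - Hphat))
           + spec_norm (Hp - Hphat))].
Proof.
move=> Hp Hphat eps sg.
have [_ [U [s [V [[svdL OE QE] [CE BE AE]]]]]] := hrun.
have [_ [Uh [sh [Vh [[svdLh OhE QhE] [ChE BhE AhE]]]]]] := hrunhat.
have eps0 : 0 <= eps by exact: spec_norm_ge0.
have sg0 : 0 < sg := hsigma.
have sg2 : 0 < sg / 2 by rewrite divr_gt0.
have [E EE Elow] := singular_value_subspace hsigma.
have s_low : forall j, sg <= s 0 j := svd_lower_bound svdL EE sg0 Elow.
(* The subspace found for L also serves [Lhat]: the perturbation costs at most eps <= sg / 2. *)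
have sh_low : forall j, sg / 2 <= sh 0 j.
  apply: (svd_lower_bound svdLh EE sg2) => y.
  have LLh : frob_norm (L *m E *m y) <=
      eps * frob_norm y + frob_norm (Lhat *m E *m y).
    rewrite -{1}(subrK Lhat L) -!mulmxA mulmxDl.
    rewrite (le_trans (frob_norm_triangle _ _)) // lerD2r.
    by rewrite (le_trans (op_le_spec_norm _ _)) // frob_norm_isometry.
  have := Elow y; have := frob_norm_ge0 y.
  have : eps <= sg / 2 := hclose.
  rewrite -/sg; nra.
have := svd_factors svdL sg0 s_low; rewrite -OE -QE.
move=> [LOQ OO QQ [pO pO1 pOa] [pQ pQ1 pQa]].
have := svd_factors svdLh sg2 sh_low; rewrite -OhE -QhE.
move=> [LOQh OOh QQh [pOh _ pOhb] [pQh _ pQhb]].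
have trace_low l (X : 'M[R]_(l, n)) :
    sg * frob_norm X ^+ 2 <= \tr (X *m (O^T *m O) *m X^T).
  by rewrite OO; exact: mxtrace_diag_lower_bound.
have [S So align] :=
  balanced_alignment (etrans OO (esym QQ)) (etrans OOh (esym QQh)) trace_low.
have [StS SSt] := So.
(* sg times the sum is at most 4 |L - Lhat|^2 <= 8 n eps^2 <= 4 n eps sg, so even 4 n eps would
   do. *)
have sum_le : frob_norm (O - Ohat *m S) ^+ 2 + frob_norm (Q - S^T *m Qhat) ^+ 2
    <= 5 * n%:R * eps.
  have := frob_norm_svd_diff svdL svdLh; rewrite -/eps.
  move: align; rewrite -LOQ -LOQh => h1 h2.
  have n0 : 0 <= n%:R :> R by exact: ler0n.
  have h3 : eps ^+ 2 <= eps * (sg / 2) by rewrite expr2 ler_wpM2l.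
  have h4 : n%:R * eps ^+ 2 <= n%:R * (eps * (sg / 2)) by rewrite ler_wpM2l.
  have h5 : 0 <= n%:R * eps * sg by rewrite !mulr_ge0 // ltW.
  rewrite -(ler_pM2l sg0); lra.
have le_sqrt k l (X : 'M[R]_(k, l)) :
    frob_norm X ^+ 2 <= 5 * n%:R * eps -> frob_norm X <= Num.sqrt (5 * n%:R * eps).
  by move=> h; rewrite -[leLHS]ger0_norm ?frob_norm_ge0 // -sqrtr_sqr ler_wsqrtr.
have O_le : frob_norm (O - Ohat *m S) <= Num.sqrt (5 * n%:R * eps).
  by apply: le_sqrt; apply: le_trans sum_le; rewrite lerDl sqr_ge0.
have Q_le : frob_norm (Q - S^T *m Qhat) <= Num.sqrt (5 * n%:R * eps).
  by apply: le_sqrt; apply: le_trans sum_le; rewrite lerDr sqr_ge0.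
exists S; split=> //.
- by rewrite O_le andbT CE ChE submxcol_mul -submxcolB frob_norm_submxcol.
- by rewrite Q_le andbT BE BhE mul_submxrow -submxrowB frob_norm_submxrow.
set a := (Num.sqrt sg)^-1; set b := 3 / 2 * a.
have a0 : 0 <= a by rewrite invr_ge0 sqrtr_ge0.
have b0 : 0 <= b by rewrite !mulr_ge0 // invr_ge0.
have op_le_b k l (X : 'M[R]_(k, l)) : op_le (Num.sqrt (sg / 2))^-1 X -> op_le b X.
  move=> hX q Y; rewrite (le_trans (hX _ _)) // ler_wpM2r ?frob_norm_ge0 //.
  exact: half_sqrt_bound.
have StO l (X : 'M[R]_(n, l)) : op_le b X -> op_le b (S^T *m X).
  by move=> hX q Y; rewrite -mulmxA frob_norm_isometry ?trmxK.
(* S^T [pinv Ohat] is the pseudoinverse of the aligned factor [Ohat] S. *)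
have O_sub : frob_norm (Defs.pinv O - S^T *m Defs.pinv Ohat) <=
    a * (a + b) * Num.sqrt (5 * n%:R * eps).
  apply: le_trans (frob_norm_pinv_sub pO pO1 (is_pinv_orth So pOh) a0 b0 pOa _) _.
    exact/StO/op_le_b.
  by rewrite ler_wpM2l // mulr_ge0 // addr_ge0.
have Q_sub : frob_norm (Defs.pinv Q - Defs.pinv Qhat *m S) <=
    a * (a + b) * Num.sqrt (5 * n%:R * eps).
  rewrite -frob_norm_tr trmxB trmx_mul.
  apply: le_trans (frob_norm_pinv_sub pQ pQ1 (is_pinv_orth So pQh) a0 b0 pQa _) _.
    exact/StO/op_le_b.
  rewrite ler_wpM2l ?mulr_ge0 ?addr_ge0 //.
  by rewrite -frob_norm_tr trmxB trmx_mul !trmxK.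
(* Regrouped this way, both state matrices are triple products built from the pseudoinverses just
   compared. *)
have -> : S^T *m Ahat *m S =
    S^T *m Defs.pinv Ohat *m Hphat *m (Defs.pinv Qhat *m S).
  by rewrite AhE !mulmxA.
rewrite AE; apply: le_trans (ho_kalman_constant n eps0 sg0 (spec_norm_ge0 Hp)
  (spec_norm_ge0 (Hp - Hphat))).
apply: frob_norm_triple_sub => //; try exact: spec_norm_ge0.
- exact/StO/op_le_b.
- by rewrite -(trmxK (Defs.pinv Q)); exact: op_le_tr.
- exact: op_le_spec_norm.
- exact: op_le_spec_norm.
(* Writing the transpose of [pinv Q] as identity times itself gives the bound a sqrt n, since the n
   by n identity has Frobenius norm sqrt n. *)
- rewrite -frob_norm_tr -[_^T]mul1mx; apply: le_trans (op_leMr _ a0 pQa) _.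
  rewrite mulrC ler_wpM2l // -[leLHS]ger0_norm ?frob_norm_ge0 //.
  rewrite -sqrtr_sqr ler_wsqrtr //.
  by rewrite frob_norm_orthonormal ?trmx1 ?mul1mx.
Qed.
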